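(* Let $H\in\mathbb S_{++}^d$ and $K\ge1$. Let $\mathcal L$ be either the subspace of diagonal matrices or the subspace of symmetric block-diagonal matrices for a fixed splitting $\mathbb R^d=V_1\oplus\cdots\oplus V_m$ of the coordinates into blocks, and let $\Pi_{\mathcal L}$ be the Frobenius-orthogonal projection onto $\mathcal L$. If there exist symmetric positive-semidefinite $P,Q\in\mathbb R^{d\times d}$ such that $$\Pi_{\mathcal L}(P-KQ)=0,\qquad \langle P-Q,H\rangle<0,$$ then no $E\in\mathcal L$ satisfies $E\preceq H\preceq KE$. Hence the diagonal, respectively block-diagonal, restricted target is empty at threshold $K$: no positive-definite $G\in\mathcal L$ satisfies $\kappa(G^{-1}H)\le K$.
   Context: $\mathbb S_{++}^d$ denotes real symmetric positive-definite $d\times d$ matrices, $\preceq$ is the Loewner order, $\langle X,Y\rangle=\operatorname{tr}(X^\top Y)$, and $\kappa(G^{-1}H)$ is the ratio of the largest to the smallest generalized eigenvalue in $Hv=\lambda Gv$. *)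

(* Defs.v *)
From HB Require Import structures.
From mathcomp Require Import all_boot all_order all_algebra.
From mathcomp Require Import boolp classical_sets reals.

Set Implicit Arguments.
Unset Strict Implicit.
Unset Printing Implicit Defensive.

Import Order.TTheory GRing.Theory Num.Theory.

Local Open Scope classical_set_scope.
Local Open Scope ring_scope.

Definition psdmx (R : realType) (d : nat) (A : 'M[R]_d) : Prop :=
  A \is symmetricmx /\ forall v : 'cV[R]_d, 0 <= (v^T *m A *m v) 0 0.

Definition posdefmx (R : realType) (d : nat) (A : 'M[R]_d) : Prop :=
  A \is symmetricmx /\ forall v : 'cV[R]_d, v != 0 -> 0 < (v^T *m A *m v) 0 0.

Definition loewner_le (R : realType) (d : nat) (A B : 'M[R]_d) : Prop :=
  psdmx (B - A).

Definition frob (R : realType) (d : nat) (X Y : 'M[R]_d) : R := \tr (X^T *m Y).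

Definition diag_space (R : realType) (d : nat) : set 'M[R]_d :=
  [set A | is_diag_mx A].

(* The splitting R^d = V_1 (+) ... (+) V_m of the coordinates is encoded by the
   map b sending a coordinate to its block: V_k is spanned by the basis vectors
   e_i with b i = k.  Blocks need not be contiguous. *)
Definition block_diag_space (R : realType) (d m : nat) (b : 'I_d -> 'I_m) :
    set 'M[R]_d :=
  [set A | A \is symmetricmx /\ forall i j, b i != b j -> A i j = 0].

(* The element B of L with A - B orthogonal to L; the default value 0 of xget
   is not used when L is a linear subspace. *)
Definition frob_proj (R : realType) (d : nat) (L : set 'M[R]_d) (A : 'M[R]_d) :
    'M[R]_d :=
  xget 0 [set B | L B /\ forall C, L C -> frob (A - B) C = 0].

Definition gen_eigenvalues (R : realType) (d : nat) (H G : 'M[R]_d) : set R :=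
  [set l | exists2 v : 'cV[R]_d, v != 0 & H *m v = l *: (G *m v)].

Definition largest (R : realType) (A : set R) : R := xget 0 (A `&` ubound A).

Definition smallest (R : realType) (A : set R) : R := xget 0 (A `&` lbound A).

(* This is kappa (G^-1 H).  For positive-definite H and G with d > 0 the set of
   generalized eigenvalues is finite, nonempty and consists of positive reals,
   so both extrema are attained. *)
Definition gen_cond (R : realType) (d : nat) (H G : 'M[R]_d) : R :=
  largest (gen_eigenvalues H G) / smallest (gen_eigenvalues H G).

(* Main.v *)
Require Import Defs.
From mathcomp Require Import all_boot all_order all_algebra.
From mathcomp Require Import boolp classical_sets reals.
From mathcomp Require Import ring lra.

Import Order.TTheory GRing.Theory Num.Theory.
Local Open Scope classical_set_scope.
Local Open Scope ring_scope.

(** The certificate is a separating functional.  Suppose [E] in [L] satisfies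
    [E <= H <= K E] in the Loewner order.  As [P - K Q] is orthogonal to [L],
    [<P, E> = K <Q, E>], hence
    [<P - Q, H> = <P, H - E> + <Q, K E - H>].  Both terms on the right pair two
    positive-semidefinite matrices, so they are nonnegative
    ([frob_psd_ge0]), which contradicts [<P - Q, H> < 0]
    ([certificate_excludes_sandwich]).  Diagonal matrices are the block-diagonal
    matrices with blocks of size one, so one orthogonality statement
    ([frob_proj0_orthogonal]) covers both choices of [L].

    The condition-number statement reduces to the first one: if [l] and [u] are
    the extreme generalized eigenvalues of [H v = x G v], then
    [l G <= H <= u G], and [u / l <= K] gives [H <= K (l G)] with [l G] in [L]
    ([gen_cond_sandwich]).  The work lies in showing that the extreme
    eigenvalues exist and give Loewner bounds.  The smallest one is obtained as
    the supremum [s] of the reals [x] with [H - x G >= 0]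
    ([pencil_min_eigenvalue]).  The supremum is attained because the condition
    holds vector by vector.  The matrix [H - s G] is singular because an
    invertible positive-semidefinite matrix dominates [c G] for some [c > 0]
    ([psd_unit_dominates]), which would allow a larger [x].  A kernel vector
    of [H - s G] is an eigenvector for [s].  The largest
    eigenvalue comes from the same argument applied to [- H].

    All estimates on positive-semidefinite matrices come from Cauchy-Schwarz
    for the form they define. *)

(** * Bilinear forms of matrices *)

Definition bform (R : realType) (d : nat) (A : 'M[R]_d) (u v : 'cV[R]_d) : R :=
  (u^T *m A *m v) 0 0.
Arguments bform {R d} A u v.

Section Forms.
Context {R : realType} {d : nat}.
Implicit Types (A B G H P M : 'M[R]_d) (u v w : 'cV[R]_d) (a l : R).

Lemma symmx_trP A : (A \is symmetricmx) <-> A^T = A.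
Proof.
by split=> [/is_hermitianmxP E|E]; [|apply/is_hermitianmxP];
   rewrite expr0 scale1r map_mx_id // in E *.
Qed.

Lemma bformDl A u v w : bform A (u + v) w = bform A u w + bform A v w.
Proof. by rewrite /bform linearD /= !mulmxDl mxE. Qed.

Lemma bformDr A u v w : bform A u (v + w) = bform A u v + bform A u w.
Proof. by rewrite /bform mulmxDr mxE. Qed.

Lemma bformZl A a u v : bform A (a *: u) v = a * bform A u v.
Proof. by rewrite /bform linearZ /= -!scalemxAl mxE. Qed.

Lemma bformZr A a u v : bform A u (a *: v) = a * bform A u v.
Proof. by rewrite /bform -scalemxAr mxE. Qed.

Lemma bform_addmx A B u v : bform (A + B) u v = bform A u v + bform B u v.
Proof. by rewrite /bform mulmxDr mulmxDl mxE. Qed.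

Lemma bform_scalemx a A u v : bform (a *: A) u v = a * bform A u v.
Proof. by rewrite /bform -scalemxAr -scalemxAl mxE. Qed.

Lemma bform_submx A B u v : bform (A - B) u v = bform A u v - bform B u v.
Proof. by rewrite bform_addmx -scaleN1r bform_scalemx mulN1r. Qed.

Lemma bform_sym A u v : A^T = A -> bform A u v = bform A v u.
Proof.
move=> sA; rewrite /bform -[in LHS](trmxK (u^T *m A *m v)) mxE.
by rewrite !trmx_mul trmxK sA mulmxA.
Qed.

Lemma bform_delta A i j : bform A (delta_mx i 0) (delta_mx j 0) = A i j.
Proof. by rewrite /bform trmx_delta -rowE -colE !mxE. Qed.

Lemma bform_rank1 u v w : bform (u *m u^T) v w = bform 1%:M u v * bform 1%:M u w.
Proof.
rewrite (bform_sym (1%:M) u v) ?trmx1 // /bform !mulmx1 mulmxA -mulmxA.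
by rewrite [LHS]mxE big_ord1.
Qed.

Lemma bform1_ge0 v : 0 <= bform 1%:M v v.
Proof.
by rewrite /bform mulmx1 mxE sumr_ge0 // => i _; rewrite mxE -expr2 sqr_ge0.
Qed.

Lemma bform1_gt0 v : v != 0 -> 0 < bform 1%:M v v.
Proof.
move=> v0; rewrite lt_neqAle bform1_ge0 andbT eq_sym.
apply: contra v0; rewrite /bform mulmx1 mxE psumr_eq0; last first.
  by move=> i _; rewrite mxE -expr2 sqr_ge0.
move=> /allP v0; apply/eqP/colP => i; rewrite mxE.
have := v0 i (mem_index_enum i).
by rewrite mxE /= mulf_eq0 orbb => /eqP.
Qed.

(** * Positive-semidefinite matrices *)

Lemma psd_bform_ge0 A v : psdmx A -> 0 <= bform A v v.
Proof. by case=> _; apply. Qed.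

Lemma psdmx_intro A : A^T = A -> (forall v, 0 <= bform A v v) -> psdmx A.
Proof. by move=> sA A0; split=> //; apply/symmx_trP. Qed.

Lemma psd_tr A : psdmx A -> A^T = A.
Proof. by case=> /symmx_trP. Qed.

Lemma psdmxD A B : psdmx A -> psdmx B -> psdmx (A + B).
Proof.
move=> pA pB; apply: psdmx_intro => [|v]; first by rewrite linearD /= !psd_tr.
by rewrite bform_addmx addr_ge0 ?psd_bform_ge0.
Qed.

Lemma psdmxZ a A : 0 <= a -> psdmx A -> psdmx (a *: A).
Proof.
move=> a0 pA; apply: psdmx_intro => [|v]; first by rewrite linearZ /= psd_tr.
by rewrite bform_scalemx mulr_ge0 ?psd_bform_ge0.
Qed.

Lemma psdmx1 : psdmx (1%:M : 'M[R]_d).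
Proof. by apply: psdmx_intro => [|v]; rewrite ?trmx1 ?bform1_ge0. Qed.

Lemma posdef_psd A : posdefmx A -> psdmx A.
Proof.
case=> sA A0; split=> // v; have [->|v0] := eqVneq v 0; last exact/ltW/A0.
by rewrite mulmx0 mxE.
Qed.

(** The form is nonnegative on every [t u + s v]; a degenerate [v] has to be
    treated apart, since the form need not be definite. *)
Lemma psd_cauchy_schwarz A u v :
  psdmx A -> bform A u v ^+ 2 <= bform A u u * bform A v v.
Proof.
move=> pA; have sA := psd_tr A pA.
have q t s : 0 <= t ^+ 2 * bform A u u + 2 * t * s * bform A u v
                  + s ^+ 2 * bform A v v.
  suff -> : t ^+ 2 * bform A u u + 2 * t * s * bform A u v + s ^+ 2 * bform A v v
    = bform A (t *: u + s *: v) (t *: u + s *: v) by apply: psd_bform_ge0.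
  rewrite bformDl !bformDr !bformZl !bformZr (bform_sym A v u) //.
  by ring.
move: q (psd_bform_ge0 _ v pA) (psd_bform_ge0 _ u pA).
move: (bform A u v) (bform A u u) (bform A v v) => b x y q y0 x0.
have [y00|yn0] := eqVneq y 0; last first.
  (* [y u - b v] is, up to scale, the part of [u] orthogonal to [v]. *)
  have yp : 0 < y by rewrite lt_neqAle eq_sym yn0.
  have := q y (- b).
  have -> : y ^+ 2 * x + 2 * y * - b * b + (- b) ^+ 2 * y = y * (x * y - b ^+ 2).
    by ring.
  by rewrite pmulr_rge0 // subr_ge0.
have [->|b0] := eqVneq b 0; first by rewrite expr0n /= mulr_ge0.
(* On [u + s v] the form is now affine in [s], with slope [2 b]; this [s]
   would make it negative. *)
have := q 1 (- (x + 1) / b); rewrite y00 mulr0 addr0.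
have -> : 1 ^+ 2 * x + 2 * 1 * (- (x + 1) / b) * b = - x - 2 by field.
by lra.
Qed.

(** * The Frobenius pairing on the positive-semidefinite cone *)

Lemma frobE A B : frob A B = \sum_i \sum_j A i j * B i j.
Proof.
rewrite /frob /mxtrace exchange_big; apply: eq_bigr => i _.
by rewrite mxE; apply: eq_bigr => j _; rewrite mxE.
Qed.

Lemma frobC A B : frob A B = frob B A.
Proof. by rewrite !frobE; under eq_bigr do under eq_bigr do rewrite mulrC. Qed.

Lemma frobDl A B M : frob (A + B) M = frob A M + frob B M.
Proof. by rewrite /frob linearD /= mulmxDl mxtraceD. Qed.

Lemma frobZl a A M : frob (a *: A) M = a * frob A M.
Proof. by rewrite /frob linearZ /= -scalemxAl mxtraceZ. Qed.

Lemma frobBl A B M : frob (A - B) M = frob A M - frob B M.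
Proof. by rewrite frobDl -scaleN1r frobZl mulN1r. Qed.

Lemma frobBr M A B : frob M (A - B) = frob M A - frob M B.
Proof. by rewrite !(frobC M) frobBl. Qed.

Lemma frobZr a M A : frob M (a *: A) = a * frob M A.
Proof. by rewrite !(frobC M) frobZl. Qed.

Lemma frob_rank1 v M : frob (v *m v^T) M = bform M v v.
Proof.
rewrite /frob trmx_mul trmxK -mulmxA mxtrace_mulC /bform /mxtrace big_ord1.
by [].
Qed.

(** Cauchy-Schwarz for the basis vectors: [P i j ^+ 2 <= P i i * P j j]. *)
Lemma psd_diag0 P i j : psdmx P -> P i i = 0 -> P i j = 0.
Proof.
move=> pP Pi0; apply/eqP; rewrite -sqrf_eq0 eq_le sqr_ge0 andbT.
have := psd_cauchy_schwarz P (delta_mx i 0) (delta_mx j 0) pP.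
by rewrite !bform_delta Pi0 mul0r.
Qed.

(** One step of Cholesky elimination.  The form of the rank-one term at [v] is
    [(e_i^T P v)^2 / P i i], which Cauchy-Schwarz bounds by the form of [P]. *)
Lemma psd_schur_step P i (p := col i P) : psdmx P -> 0 < P i i ->
  psdmx (P - (P i i)^-1 *: (p *m p^T)).
Proof.
move=> pP a0; apply: psdmx_intro => [|v].
  by rewrite linearB /= linearZ /= trmx_mul trmxK psd_tr.
rewrite bform_submx bform_scalemx bform_rank1 subr_ge0.
rewrite -(ler_pM2l a0) mulVKf ?gt_eqF // -expr2.
have -> : bform 1%:M p v = bform P (delta_mx i 0) v.
  by rewrite /bform mulmx1 /p colE trmx_mul psd_tr.
by rewrite -(bform_delta P i i); apply: psd_cauchy_schwarz.
Qed.

(** The cone is self-dual: elimination writes [P] as a sum of rank-one terms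
    [p p^T] with positive coefficients, and such a term pairs with [M] to
    [p^T M p >= 0].  The induction is on the number of nonzero diagonal entries
    of [P]: an elimination step clears one and creates none. *)
Lemma frob_psd_ge0 P M : psdmx P -> psdmx M -> 0 <= frob P M.
Proof.
move=> pP pM; have [n] := ubnP #|[pred i | P i i != 0]|.
elim: n P pP => // n IHn P pP cardP.
have [i Pi|P0] := pickP [pred i | P i i != 0]; last first.
  rewrite frobE big1 // => i _; rewrite big1 // => j _.
  by rewrite psd_diag0 ?mul0r //; apply/eqP; have /= := P0 i; case: eqP.
have a0 : 0 < P i i.
  by rewrite lt_neqAle eq_sym (Pi : P i i != 0) -(bform_delta P) psd_bform_ge0.
set p := col i P; set P' := P - (P i i)^-1 *: (p *m p^T).
have pP' : psdmx P' by exact: psd_schur_step.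
have -> : frob P M = frob P' M + (P i i)^-1 * bform M p p.
  by rewrite frobBl frobZl frob_rank1 subrK.
apply: addr_ge0; last by rewrite mulr_ge0 ?invr_ge0 ?psd_bform_ge0 ?(ltW a0).
apply: IHn => //; rewrite ltnS in cardP; apply: leq_trans cardP.
have P'E j : P' j j = P j j - (P i i)^-1 * P j i ^+ 2.
  by rewrite !mxE big_ord1 !mxE expr2.
apply: proper_card; apply/properP; split.
  apply/fintype.subsetP => j; rewrite !inE P'E; apply: contra => /eqP Pj0.
  by rewrite (psd_diag0 P j i) // Pj0 expr0n /= mulr0 subrr.
exists i => //; rewrite inE negbK P'E expr2 mulrA mulVf ?mul1r ?subrr //.
Qed.

(** By Cauchy-Schwarz [|v|^2 I - v v^T] is positive-semidefinite; pair it with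
    [A]. *)
Lemma psd_le_trace A v : psdmx A -> bform A v v <= \tr A * bform 1%:M v v.
Proof.
move=> pA.
have pN : psdmx (bform 1%:M v v *: 1%:M - v *m v^T).
  apply: psdmx_intro => [|w].
    by rewrite linearB /= linearZ /= trmx1 trmx_mul trmxK.
  rewrite bform_submx bform_scalemx bform_rank1 subr_ge0 -expr2.
  exact/psd_cauchy_schwarz/psdmx1.
have := frob_psd_ge0 _ _ pA pN.
rewrite frobBr frobZr (frobC A (v *m _)) frob_rank1 subr_ge0 mulrC.
by rewrite /frob mulmx1 mxtrace_tr.
Qed.

(** Cauchy-Schwarz for [A] at [v] and [A^-1 v] gives
    [|v|^4 <= (v^T A v) (v^T A^-1 v)], and [psd_le_trace] bounds the last factor
    by [\tr A^-1 |v|^2]. *)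
Lemma psd_unit_coercive A v : psdmx A -> A \in unitmx ->
  bform 1%:M v v <= \tr (invmx A) * bform A v v.
Proof.
move=> pA uA; have sA := psd_tr A pA.
have pV : psdmx (invmx A).
  apply: psdmx_intro => [|w]; first by rewrite trmx_inv sA.
  have := psd_bform_ge0 A (invmx A *m w) pA.
  by rewrite /bform trmx_mul trmx_inv sA mulmxKV // mulmxA.
have [->|v0] := eqVneq v 0; first by rewrite /bform !mulmx0 mxE mulr0.
have v_gt0 := bform1_gt0 v v0.
have cs := psd_cauchy_schwarz A v (invmx A *m v) pA.
have E1 : bform A v (invmx A *m v) = bform 1%:M v v.
  by rewrite /bform mulmx1 mulmxA mulmxK.
have E2 : bform A (invmx A *m v) (invmx A *m v) = bform (invmx A) v v.
  by rewrite /bform trmx_mul trmx_inv sA mulmxKV // mulmxA.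
rewrite E1 E2 in cs.
rewrite -(ler_pM2l v_gt0) -expr2 (le_trans cs) // mulrC.
rewrite [X in _ <= X]mulrCA mulrA ler_wpM2r ?psd_bform_ge0 //.
exact: psd_le_trace.
Qed.

(** Chain [v^T G v <= \tr G |v|^2] with
    [|v|^2 <= \tr A^-1 (v^T A v)]. *)
Lemma psd_unit_dominates A G : psdmx A -> A \in unitmx -> psdmx G ->
  exists2 c, 0 < c & psdmx (A - c *: G).
Proof.
move=> pA uA pG.
(* Adding 1 to the traces keeps the constant positive when they vanish,
   which happens in dimension 0 or for [G = 0]. *)
pose g := `|\tr G| + 1.
have g0 : 0 < g by rewrite ltr_wpDl.
exists ((`|\tr (invmx A)| + 1)^-1 / g); first by rewrite divr_gt0 // invr_gt0 ltr_wpDl.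
apply: psdmx_intro => [|v]; first by rewrite linearB /= linearZ /= !psd_tr.
rewrite bform_submx bform_scalemx subr_ge0 -mulrA ler_pdivrMl ?ltr_wpDl //.
rewrite ler_pdivrMl //.
have h1 := psd_le_trace G v pG; have h2 := psd_unit_coercive A v pA uA.
have q1 := bform1_ge0 v; have q2 := psd_bform_ge0 A v pA.
apply: (le_trans h1); apply: (@le_trans _ _ (g * bform 1%:M v v)).
  by rewrite ler_wpM2r // /g (le_trans (ler_norm _)) // lerDl.
rewrite ler_wpM2l ?(ltW g0) // (le_trans h2) //.
by rewrite ler_wpM2r // (le_trans (ler_norm _)) // lerDl.
Qed.

Lemma psd_singular A : psdmx A -> A \notin unitmx ->
  exists2 v : 'cV[R]_d, v != 0 & A *m v = 0.
Proof.
move=> pA; rewrite unitmxE unitfE negbK => /det0P[u u0 uA].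
exists u^T; first by rewrite trmx_eq0.
by rewrite -{1}(psd_tr A pA) -trmx_mul uA trmx0.
Qed.

(** * Extreme generalized eigenvalues *)

Lemma posdef_unit G : posdefmx G -> G \in unitmx.
Proof.
move=> pdG; apply: contraT => /(psd_singular _ (posdef_psd _ pdG))[v v0 Gv].
by have := pdG.2 v v0; rewrite -mulmxA Gv mulmx0 mxE ltxx.
Qed.

(** Asking for some [l] with [H - l G >= 0], rather than for [H >= 0], makes
    the lemma apply to [- H] as well, which yields the largest eigenvalue. *)
Lemma pencil_min_eigenvalue H G : (0 < d)%N -> posdefmx G ->
  (exists l, psdmx (H - l *: G)) ->
  exists2 l, psdmx (H - l *: G) & gen_eigenvalues H G l.
Proof.
move=> d0 pdG [l0 Sl0]; have pG := posdef_psd G pdG.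
have sG := psd_tr G pG.
have sH : H^T = H.
  have := psd_tr _ Sl0; rewrite linearB /= linearZ /= sG; exact: addIr.
pose S := [set l | psdmx (H - l *: G)].
have S0 : S !=set0 by exists l0.
pose e : 'cV[R]_d := delta_mx (Ordinal d0) 0.
have e0 : e != 0.
  by apply/negP => /eqP/matrixP/(_ (Ordinal d0) 0); rewrite !mxE !eqxx => /eqP;
  rewrite oner_eq0.
(* The Rayleigh quotient at any nonzero vector bounds [S]. *)
have Sub : ubound S (bform H e e / bform G e e).
  move=> l /psd_bform_ge0-/(_ e); rewrite bform_submx bform_scalemx subr_ge0.
  by rewrite ler_pdivlMr //; apply: pdG.2.
have supS : has_sup S by split=> //; exists (bform H e e / bform G e e).
have pS : psdmx (H - sup S *: G).
  apply: psdmx_intro => [|v]; first by rewrite linearB /= linearZ /= sG sH.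
  rewrite bform_submx bform_scalemx subr_ge0.
  have [->|v0] := eqVneq v 0; first by rewrite /bform !mulmx0 !mxE mulr0.
  have Gv : 0 < bform G v v by apply: pdG.2.
  rewrite -ler_pdivlMr //; apply: ge_sup => // l /psd_bform_ge0-/(_ v).
  by rewrite bform_submx bform_scalemx subr_ge0 ler_pdivlMr.
exists (sup S) => //; have [u|nu] := boolP (H - sup S *: G \in unitmx).
  have [c c0 pc] := psd_unit_dominates _ _ pS u pG.
  have : S (sup S + c) by rewrite /S /= scalerDl opprD addrA.
  by move=> /(sup_upper_bound supS); lra.
have [v v0 Hv] := psd_singular _ pS nu; exists v => //.
by apply/eqP; rewrite -subr_eq0 scalemxAl -mulmxBl Hv.
Qed.

Lemma gen_eigenvalue_bform H G l : gen_eigenvalues H G l ->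
  exists2 v, v != 0 & bform H v v = l * bform G v v.
Proof.
move=> [v v0 Hv]; exists v => //.
by rewrite /bform -mulmxA Hv -scalemxAr mxE mulmxA.
Qed.

Lemma gen_eigenvalues_extremal H G : (0 < d)%N -> posdefmx G -> psdmx H ->
  [/\ psdmx (H - Defs.smallest (gen_eigenvalues H G) *: G),
      psdmx (largest (gen_eigenvalues H G) *: G - H) &
      gen_eigenvalues H G (Defs.smallest (gen_eigenvalues H G))].
Proof.
move=> d0 pdG pH; set S := gen_eigenvalues H G; have pG := posdef_psd G pdG.
have [l pl Sl] : exists2 l, psdmx (H - l *: G) & S l.
  by apply: pencil_min_eigenvalue => //; exists 0; rewrite scale0r subr0.
have [c c0 pc] := psd_unit_dominates G H pG (posdef_unit G pdG) pH.
have [m pm [w w0 Hw]] :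
    exists2 m, psdmx (- H - m *: G) & gen_eigenvalues (- H) G m.
  apply: pencil_min_eigenvalue => //; exists (- c^-1).
  have -> : - H - - c^-1 *: G = c^-1 *: (G - c *: H).
    by rewrite scalerBr scalerA mulVf ?gt_eqF // scale1r scaleNr opprK addrC.
  by apply: psdmxZ => //; rewrite invr_ge0 ltW.
have Sm : S (- m).
  by exists w => //; apply: oppr_inj; rewrite -mulNmx Hw scaleNr opprK.
have lS : lbound S l.
  move=> k /gen_eigenvalue_bform[v v0 Hv]; have Gv : 0 < bform G v v := pdG.2 v v0.
  have := psd_bform_ge0 _ v pl; rewrite bform_submx bform_scalemx Hv.
  by rewrite subr_ge0 ler_pM2r.
have uS : ubound S (- m).
  move=> k /gen_eigenvalue_bform[v v0 Hv]; have Gv : 0 < bform G v v := pdG.2 v v0.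
  have := psd_bform_ge0 _ v pm.
  rewrite bform_submx bform_scalemx -scaleN1r bform_scalemx Hv.
  by rewrite mulN1r subr_ge0 lerNr -mulNr ler_pM2r.
have -> : Defs.smallest S = l.
  apply: xget_unique => // k [Sk kS]; apply/eqP.
  by rewrite eq_le lS // kS.
have -> : largest S = - m.
  apply: xget_unique => // k [Sk kS]; apply/eqP.
  by rewrite eq_le uS // kS.
by split=> //; rewrite scaleNr addrC.
Qed.

(** With [l <= u] the extreme eigenvalues, [H <= u G <= K l G]. *)
Lemma gen_cond_sandwich H G K : (0 < d)%N -> posdefmx G -> posdefmx H ->
  gen_cond H G <= K ->
  exists l, loewner_le (l *: G) H /\ loewner_le H (K *: (l *: G)).
Proof.
move=> d0 pdG pdH.
have [] := gen_eigenvalues_extremal H G d0 pdG (posdef_psd H pdH).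
rewrite /gen_cond; set l := Defs.smallest _; set u := largest _ => pl pu El le_K.
have l0 : 0 < l.
  have [v v0 Hv] := gen_eigenvalue_bform H G l El.
  have : 0 < bform H v v := pdH.2 v v0.
  by rewrite Hv pmulr_lgt0 //; apply: pdG.2.
exists l; split=> //; rewrite /loewner_le.
have -> : K *: (l *: G) - H = (K * l - u) *: G + (u *: G - H).
  by rewrite scalerA scalerBl addrA subrK.
apply: psdmxD => //; apply: psdmxZ; last exact: posdef_psd.
by rewrite subr_ge0 -ler_pdivrMr.
Qed.

(** * The restricted subspaces and the certificate *)

Lemma diag_space_blocks : @diag_space R d = block_diag_space id.
Proof.
apply/seteqP; split=> A /=.
  move=> /is_diag_mxP dA; split; last first.
    by move=> i j ij; apply: dA.
  apply/symmx_trP/matrixP => i j; rewrite mxE.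
  have [->//|ij] := eqVneq i j; rewrite !dA // eq_sym //.
by move=> [_ A0]; apply/is_diag_mxP => i j ij; apply: A0.
Qed.

(** Since [frob_proj] returns 0 when no projection exists, its vanishing
    carries information only once a projection is exhibited: here the block part
    of [A], which lies in the space because [A] is symmetric. *)
Lemma frob_proj0_orthogonal m (b : 'I_d -> 'I_m) A C : A^T = A ->
  frob_proj (block_diag_space b) A = 0 -> block_diag_space b C -> frob A C = 0.
Proof.
move=> sA projA0 LC.
have : exists B, block_diag_space b B /\
    forall D, block_diag_space b D -> frob (A - B) D = 0.
  exists (\matrix_(i, j) if b i == b j then A i j else 0); split.
    split=> [|i j /negPf bij]; last by rewrite mxE bij.
    apply/symmx_trP/matrixP => i j; rewrite !mxE eq_sym.
    by rewrite -{1}sA mxE.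
  move=> D [_ D0]; rewrite frobE big1 // => i _; rewrite big1 // => j _.
  rewrite !mxE; case: eqP => [|/eqP bij]; first by rewrite subrr mul0r.
  by rewrite D0 // mulr0.
move=> /(xgetPex 0)[_]; rewrite -/(frob_proj _ A) projA0 subr0; exact.
Qed.

(** [<P - Q, H> = <P, H - E> + <Q, K E - H>] once [<P, E> = K <Q, E>]. *)
Lemma certificate_excludes_sandwich H E P Q K : psdmx P -> psdmx Q ->
  frob (P - K *: Q) E = 0 -> frob (P - Q) H < 0 ->
  ~ (loewner_le E H /\ loewner_le H (K *: E)).
Proof.
move=> pP pQ PQE neg [EH HKE].
have := frob_psd_ge0 _ _ pP EH; have := frob_psd_ge0 _ _ pQ HKE.
move: PQE neg; rewrite !frobBl !frobBr frobZl frobZr; lra.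
Qed.

End Forms.

Theorem proposition4p6 (R : realType) (d : nat) (H : 'M[R]_d) (K : R)
    (L : set 'M[R]_d) :
  posdefmx H -> 1 <= K ->
  (L = @diag_space R d \/
   exists (m : nat) (b : 'I_d -> 'I_m), L = @block_diag_space R d m b) ->
  (exists P Q : 'M[R]_d,
     [/\ psdmx P, psdmx Q, frob_proj L (P - K *: Q) = 0 & frob (P - Q) H < 0]) ->
  (forall E : 'M[R]_d, L E -> ~ (loewner_le E H /\ loewner_le H (K *: E))) /\
  (forall G : 'M[R]_d, L G -> posdefmx G -> ~ (gen_cond H G <= K)).
Proof.
move=> pdH _ LE [P [Q [pP pQ proj0 neg]]].
have {LE} [m [b LE]] : exists m (b : 'I_d -> 'I_m), L = block_diag_space b.
  by case: LE => [->|//]; exists d, id; apply: diag_space_blocks.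
subst L.
have no_sandwich E : block_diag_space b E ->
    ~ (loewner_le E H /\ loewner_le H (K *: E)).
  move=> LE; apply: (certificate_excludes_sandwich H E P Q K) => //.
  apply: frob_proj0_orthogonal LE => //.
  by rewrite linearB /= linearZ /= !psd_tr.
split=> // G LG pdG condK.
(* In dimension 0 every pairing vanishes, so [neg] forces [d > 0]; the extreme
   eigenvalues exist only then. *)
have d0 : (0 < d)%N.
  rewrite lt0n; apply/negP => /eqP d0; move: neg.
  by rewrite frobE big1 ?ltxx // => i; move: (ltn_ord i); rewrite {2}d0.
have [l lG] := gen_cond_sandwich H G K d0 pdG pdH condK.
apply: (no_sandwich (l *: G)) lG.
case: LG => /symmx_trP sG G0; split; first by apply/symmx_trP; rewrite linearZ /= sG.
by move=> i j bij; rewrite mxE G0 ?mulr0.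
Qed.
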